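(* Let $\chi$ be a finite or countable alphabet, let $\mu,\nu$ be stationary probability measures on $\chi^{\mathbb{N}}$, and suppose $\nu$ has complete grammar. Then: (a) For all integers $n\ge 2$ and $1\le k\le n-1$, $\ \mathbb{P}(n-T_n^{(2)}\ge k)=\mathbb{E}_{\mu,\nu}(k)+a^{(2)}_{k,n}$. (b) For every integer $k\ge 1$, $\ \displaystyle\lim_{n\to\infty}\mathbb{P}(n-T_n^{(2)}\ge k)=\mathbb{E}_{\mu,\nu}(k)+a^{(2)}_k$.
   Context: $\sigma$ is the left shift on $\chi^{\mathbb{N}}$, $\mathbb{N}=\{0,1,2,\dots\}$, and $x_m^n=x_mx_{m+1}\cdots x_n$. A string $\omega\in\chi^n$ is identified with the cylinder $\{\mathbf{x}\in\chi^{\mathbb{N}}: x_0^{n-1}=\omega\}$; $\mu\nu(\omega)=\mu(\omega)\nu(\omega)$. Stationary means $\sigma$-invariant, and $\mathbb{P}=\mu\times\nu$. The measure $\nu$ has complete grammar if $\nu(\omega)>0$ for all $n\ge1$ and all $\omega\in\chi^n$. Shortest-path function: $T_n^{(2)}(\mathbf{x},\mathbf{y})=\inf\{k\ge 1: y_0^{n-1}\cap\sigma^{-k}(x_0^{n-1})\ne\emptyset\}$ for $(\mathbf{x},\mathbf{y})\in\chi^{\mathbb{N}}\times\chi^{\mathbb{N}}$. $k$-divergence: $\mathbb{E}_{\mu,\nu}(k)=\sum_{\omega\in\chi^k}\mu\nu(\omega)$. For $1\le j\le m-1$ let $R_m(j)=\{x_0^{m-1}\in\chi^m: x_{m-j}^{m-1}=x_0^{j-1}\}$.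 Set $a^{(2)}_{n-1,n}=0$ and, for $1\le k\le n-2$, $$a^{(2)}_{k,n}=\sum_{m=k+1}^{n-1}\ \sum_{\omega\in\chi^m,\ \omega\notin\bigcup_{j=k}^{m-1}R_m(j)}\mu\nu(\omega),$$ and, for $k\ge1$, $$a^{(2)}_{k}=\sum_{m=k+1}^{\infty}\ \sum_{\omega\in\chi^m,\ \omega\notin\bigcup_{j=k}^{m-1}R_m(j)}\mu\nu(\omega).$$ *)

(* Defs.v *)
From mathcomp Require Import all_boot all_order all_algebra.
From mathcomp Require Import all_classical all_reals all_analysis.

Set Implicit Arguments.
Unset Strict Implicit.
Unset Printing Implicit Defensive.

Import Order.TTheory GRing.Theory Num.Theory.

Local Open Scope classical_set_scope.
Local Open Scope ring_scope.
Local Open Scope ereal_scope.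

Section sequence_space.
Variable chi : pointedType.
Implicit Types (x y : nat -> chi) (n m j k : nat).

Definition initial_word n x : n.-tuple chi := [tuple x i | i < n].

Definition cylinder n (w : n.-tuple chi) : set (nat -> chi) :=
  [set x | initial_word n x = w].

Definition cylinders : set (set (nat -> chi)) :=
  [set A | exists n (w : n.-tuple chi), A = cylinder w].

(* When chi is countable, the cylinder sigma-algebra is the product over nat
   of the discrete sigma-algebras on chi. *)
Definition sequence_space := g_sigma_algebraType cylinders.

Definition left_shift x : nat -> chi := fun i => x i.+1.

(* R_m(j): the words of length m whose last j letters are their first j
   letters; meaningful for 1 <= j <= m - 1. *)
Definition self_overlap m j : set (m.-tuple chi) :=
  [set w | drop (m - j) w = take j w].

Arguments self_overlap : clear implicits.

Definition new_words m k : set (m.-tuple chi) :=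
  ~` \bigcup_(j in [set j | (k <= j <= m.-1)%N]) self_overlap m j.

Arguments new_words : clear implicits.

Variable R : realType.

(* Extended real valued, so that the infimum of the empty set is +oo. *)
Definition shortest_path n x y : \bar R :=
  ereal_inf [set k%:R%:E | k in
    [set k : nat | (1 <= k)%N /\
       cylinder (initial_word n y) `&`
       (iter k left_shift @^-1` cylinder (initial_word n x)) !=set0]].

Definition stationary (mu : set sequence_space -> \bar R) :=
  forall A : set sequence_space, measurable A ->
    mu (left_shift @^-1` A) = mu A.

Definition complete_grammar (nu : set sequence_space -> \bar R) :=
  forall n (w : n.-tuple chi), (1 <= n)%N -> 0 < nu (cylinder w).

Variables mu nu : set sequence_space -> \bar R.

Definition word_weight n (w : n.-tuple chi) : \bar R :=
  mu (cylinder w) * nu (cylinder w).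

Definition divergence k : \bar R :=
  \esum_(w in [set: k.-tuple chi]) word_weight w.

Definition a2_fin k n : \bar R :=
  \sum_(k.+1 <= m < n) \esum_(w in new_words m k) word_weight w.

Definition a2_inf k : \bar R :=
  \sum_(k.+1 <= m <oo) \esum_(w in new_words m k) word_weight w.

(* The boundary convention k = n - 1 is the empty sum. *)
Lemma a2_fin_last n : (2 <= n)%N -> a2_fin n.-1 n = 0.
Proof. by case: n => // n _; rewrite /a2_fin big_geq. Qed.

End sequence_space.

(* Main.v *)
Require Import Defs.
From mathcomp Require Import all_boot all_order all_algebra.
From mathcomp Require Import all_classical all_reals all_analysis.
From mathcomp Require Import zify.

(* A sequence can start with y_0^{n-1} and continue with x_0^{n-1} from position
   j <= n on iff the last m = n - j letters of y_0^{n-1} are x_0^{m-1}; so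
   n - T_n >= k means that such a match occurs for some m with k <= m < n.
   Given a match of length m with word w, a match of length j < m occurs iff w
   is in R_m(j); taking the shortest match of length at least k thus makes the
   union disjoint and selects the words outside R_m(k), ..., R_m(m-1).  By
   stationarity of nu a match with the word w has probability mu(w) nu(w), and
   the length m = k contributes all words. *)

Import Order.TTheory GRing.Theory Num.Theory.

Local Open Scope classical_set_scope.
Local Open Scope ring_scope.
Local Open Scope ereal_scope.

(** * Unions over countable index sets *)

Section countable_unions.
Set Implicit Arguments.
Unset Strict Implicit.

(** An injection of D into [nat] and its partial inverse turn the union into one indexed by natural
    numbers. This is meant for unions over sets of words. *)
Lemma countable_bigcup_measurable d (T : sigmaRingType d) (I : choiceType)
    (D : set I) (F : I -> set T) : countable D ->
  (forall i, D i -> measurable (F i)) -> measurable (\bigcup_(i in D) F i).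
Proof.
(* The partial inverse takes i0 in D as its default value, so the empty D is settled first. *)
move=> cD mF; have [->|/set0P[i0 Di0]] := eqVneq D set0.
  by rewrite bigcup_set0.
have /countable_injP[f injf] := cD.
have inv i : D i -> 'pinv_(cst i0) D f (f i) = i.
  by move=> Di; rewrite pinvKV ?inE.
rewrite (_ : \bigcup_(i in D) F i =
  \bigcup_(n in f @` D) F ('pinv_(cst i0) D f n)).
  by apply: bigcup_measurable => _ [i Di <-]; rewrite inv//; exact: mF.
by rewrite bigcup_image; apply: eq_bigcupr => i Di; rewrite inv.
Qed.

Lemma measure_countable_bigcup d (T : measurableType d) (R : realType)
    (mu : {measure set T -> \bar R}) (I : choiceType) (D : set I)
    (F : I -> set T) :
  countable D -> (forall i, D i -> measurable (F i)) -> trivIset D F ->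
  mu (\bigcup_(i in D) F i) = \esum_(i in D) mu (F i).
Proof.
move=> cD mF tF; have [->|/set0P[i0 Di0]] := eqVneq D set0.
  by rewrite bigcup_set0 measure0 esum_set0.
have /countable_injP[f injf] := cD.
have inv i : D i -> 'pinv_(cst i0) D f (f i) = i.
  by move=> Di; rewrite pinvKV ?inE.
rewrite (_ : \bigcup_(i in D) F i =
  \bigcup_(n in f @` D) F ('pinv_(cst i0) D f n)); last first.
  by rewrite bigcup_image; apply: eq_bigcupr => i Di; rewrite inv.
rewrite measure_bigcup.
- rewrite nneseries_esum; last by move=> *; exact: measure_ge0.
  rewrite set_mem_set esum_image//.
  by apply: eq_esum => i Di; rewrite inv.
- by move=> _ [i Di <-]; rewrite inv//; exact: mF.
- apply: trivIset_image => i j Di Dj /=; rewrite !inv//; exact: tF.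
Qed.

End countable_unions.

(** * Matches, self-overlaps and the shortest path *)

Section words.
Set Implicit Arguments.
Unset Strict Implicit.
Variable chi : pointedType.
Implicit Types x y z : nat -> chi.

Lemma initial_wordP n x y :
  initial_word n x = initial_word n y <-> forall i, (i < n)%N -> x i = y i.
Proof.
split=> [xy i ni|xy].
  by have := congr1 (fun w => tnth w (Ordinal ni)) xy; rewrite !tnth_mktuple.
by apply: eq_from_tnth => i; rewrite !tnth_mktuple xy.
Qed.

Lemma iter_left_shiftE j x i : iter j (@left_shift chi) x i = x (j + i)%N.
Proof. by elim: j i => // j IH i; rewrite iterS /left_shift IH addnS. Qed.

Lemma nth_initial_word n x i : (i < n)%N ->
  nth point (initial_word n x) i = x i.
Proof. by move=> ni; rewrite -[i]/(val (Ordinal ni)) nth_mktuple. Qed.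

Lemma drop_initial_word j m x :
  drop j (initial_word (j + m) x) =
  initial_word m (iter j (@left_shift chi) x) :> seq chi.
Proof.
apply: (@eq_from_nth _ point); first by rewrite size_drop !size_tuple addKn.
move=> i; rewrite size_drop size_tuple addKn => im.
by rewrite nth_drop !nth_initial_word ?ltn_add2l// iter_left_shiftE.
Qed.

Lemma take_initial_word j m x : (j <= m)%N ->
  take j (initial_word m x) = initial_word j x :> seq chi.
Proof.
move=> jm; have sz : size (take j (initial_word m x)) = j.
  by rewrite size_takel// size_tuple.
apply: (@eq_from_nth _ point); first by rewrite sz size_tuple.
move=> i; rewrite sz => ij.
by rewrite nth_take// !nth_initial_word// (leq_trans ij).
Qed.

Lemma self_overlap_initial_word m j x : (j <= m)%N ->
  self_overlap j (initial_word m x) <->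
  forall i, (i < j)%N -> x (m - j + i)%N = x i.
Proof.
move=> jm; rewrite /self_overlap /= take_initial_word//.
have := drop_initial_word (m - j) j x; rewrite subnK// => ->.
split=> [/val_inj/initial_wordP h i ij|h].
  by rewrite -[RHS]h// iter_left_shiftE.
by congr tval; apply/initial_wordP => i ij; rewrite iter_left_shiftE h.
Qed.

(** Phrased with a shift of y rather than a suffix of [initial_word n y]: for a fixed word, the
    condition on y is then a preimage of a cylinder, to which stationarity applies. *)
Definition match_length n m x y :=
  initial_word m x = initial_word m (iter (n - m) (@left_shift chi) y).

Lemma match_lengthP n m x y : match_length n m x y <->
  forall i, (i < m)%N -> x i = y (n - m + i)%N.
Proof.
split=> [/initial_wordP h i im|h]; first by rewrite h// iter_left_shiftE.
by apply/initial_wordP => i im; rewrite iter_left_shiftE h.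
Qed.

(** By the match of length m, the last j letters of x_0^{m-1} are those of y_0^{n-1}, so both sides
    compare the same letters with x_0^{j-1}. *)
Lemma match_length_overlap n m j x y : (j <= m)%N -> (m <= n)%N ->
  match_length n m x y ->
  self_overlap j (initial_word m x) <-> match_length n j x y.
Proof.
move=> jm mn /match_lengthP h; rewrite self_overlap_initial_word//.
have e i : (i < j)%N -> x (m - j + i)%N = y (n - j + i)%N.
  by move=> ij; rewrite h; [congr y; lia|lia].
split=> [h'|/match_lengthP h' i ij]; last by rewrite e// -h'.
by apply/match_lengthP => i ij; rewrite -e// h'.
Qed.

(* The witness on the right-hand side is the shortest matching length >= k. *)
Lemma match_length_new n k x y : (0 < k)%N ->
  (exists2 m, (k <= m < n)%N & match_length n m x y) <->
  (exists2 m, (k <= m < n)%N &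
     match_length n m x y /\ new_words k (initial_word m x)).
Proof.
move=> k0; split=> [[m0 km0 hm0]|[m km [hm _]]]; last by exists m.
have : exists m, (k <= m < n)%N && `[< match_length n m x y >].
  by exists m0; rewrite km0; apply/asboolP.
case/ex_minnP => m /andP[km /asboolP hm] minm; exists m => //; split=> //.
move=> [j /= kj] /match_length_overlap -/(_ n y) oj.
have {}oj : match_length n j x y by apply: oj => //; lia.
have : (m <= j)%N by apply: minm; apply/andP; split; [lia|apply/asboolP].
lia.
Qed.

(** The shorter of two distinct matches would be a self-overlap of the longer word, of a length that
    [new_words] excludes. *)
Lemma match_length_new_inj n k m m' x y :
  (k <= m < n)%N -> (k <= m' < n)%N ->
  match_length n m x y -> new_words k (initial_word m x) ->
  match_length n m' x y -> new_words k (initial_word m' x) -> m = m'.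
Proof.
wlog mm' : m m' / (m <= m')%N.
  move=> H; have [|/ltnW] := leqP m m'; first exact: H.
  by move=> m'm *; apply/esym; apply: (H m' m).
move=> km km' hm _ hm' N; apply/eqP; rewrite eqn_leq mm' leqNgt.
apply/negP => ltmm'; apply: N; exists m; first by rewrite /=; lia.
by apply/(@match_length_overlap n m' m x y) => //; lia.
Qed.

Lemma shift_cylinder_meets n j x y : (j <= n)%N ->
  cylinder (initial_word n y) `&`
    (iter j (@left_shift chi) @^-1` cylinder (initial_word n x)) !=set0 <->
  match_length n (n - j) x y.
Proof.
move=> jn; rewrite match_lengthP (_ : n - (n - j) = j)%N; last by lia.
split=> [[z [/initial_wordP zy /initial_wordP zx]] i ij|h].
  by rewrite -zy -?zx ?iter_left_shiftE//; lia.
(* On positions j to n - 1 both words prescribe a letter, and there the match makes them agree. *)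
exists (fun i => if (i < n)%N then y i else x (i - j)%N); split.
  by apply/initial_wordP => i ->.
apply/initial_wordP => i ni; rewrite iter_left_shiftE.
by case: ifPn => jin; [rewrite h//; lia|rewrite addKn].
Qed.

(** The shift by n is always admissible, since the empty match holds; the infimum is therefore a
    minimum, finite and at most n. *)
Lemma shortest_path_attained (R : realType) n x y : (1 <= n)%N ->
  exists j, [/\ (1 <= j <= n)%N, match_length n (n - j) x y,
    shortest_path R n x y = j%:R%:E &
    forall i, (1 <= i <= n)%N -> match_length n (n - i) x y -> (j <= i)%N].
Proof.
move=> n1.
have : exists j, (1 <= j <= n)%N && `[< match_length n (n - j) x y >].
  exists n; rewrite n1 leqnn; apply/asboolP; rewrite subnn.
  exact/match_lengthP.
case/ex_minnP => j /andP[jn /asboolP hj] minj.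
have {}minj i : (1 <= i <= n)%N -> match_length n (n - i) x y -> (j <= i)%N.
  by move=> ni hi; apply: minj; rewrite ni; apply/asboolP.
exists j; split=> //; apply/eqP; rewrite eq_le; apply/andP; split.
  apply: ereal_inf_lbound; exists j => //; split; first by case/andP: jn.
  by apply/shift_cylinder_meets => //; case/andP: jn.
apply: le_ereal_inf_tmp => _ [i [i1 hi] <-]; rewrite lee_fin ler_nat.
have [ni|ni] := leqP i n; last by lia.
by apply: minj; [rewrite i1|apply/shift_cylinder_meets].
Qed.

Lemma shortest_path_le (R : realType) n k x y : (1 <= k < n)%N ->
  (k%:R%:E <= n%:R%:E - shortest_path R n x y) <->
  (exists2 m, (k <= m < n)%N & match_length n m x y).
Proof.
move=> kn; have [|j [jn hj -> minj]] := @shortest_path_attained R n x y.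
  by lia.
rewrite -EFinB lee_fin lerBrDr -natrD ler_nat; split=> [kj|[m km hm]].
  by exists (n - j)%N => //; lia.
have : (j <= n - m)%N by apply: minj; [lia|rewrite subKn//; lia].
lia.
Qed.

End words.

(** * Measurability and probability of matches *)

Section match_probability.
Set Implicit Arguments.
Unset Strict Implicit.
Variables (R : realType) (chi : pointedType).
Hypothesis chi_countable : countable [set: chi].

Lemma countable_tuple n : countable [set: n.-tuple chi].
Proof.
have /countable_injP[f injf] := chi_countable.
(* Letters become numbers through f, and the resulting list of numbers is then coded by one
   number. *)
apply/countable_injP; exists (fun w : n.-tuple chi => choice.pickle (map f w)).
move=> v w _ _ /(pcan_inj choice.pickleK)/inj_map vw.
by apply/val_inj/vw => a b; apply: injf; rewrite inE.
Qed.

Lemma countable_words m (W : set (m.-tuple chi)) : countable W.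
Proof.
exact: sub_countable (subset_card_le (@subsetT _ W)) (countable_tuple m).
Qed.

Lemma measurable_initial_word n (W : set (n.-tuple chi)) :
  measurable ([set x | W (initial_word n x)] : set (sequence_space chi)).
Proof.
rewrite (_ : mkset _ = \bigcup_(w in W) (cylinder w)).
  apply: countable_bigcup_measurable.
    exact: countable_words.
  by move=> w _; apply: sub_sigma_algebra; exists n, w.
apply/seteqP; split=> x /=; first by exists (initial_word n x).
by move=> [w Ww ->].
Qed.

(** Membership depends on the first j + m coordinates only. *)
Lemma measurable_shift_cylinder j m (w : m.-tuple chi) :
  measurable (iter j (@left_shift chi) @^-1` cylinder w
    : set (sequence_space chi)).
Proof.
rewrite (_ : _ @^-1` _ =
  [set x | drop j (initial_word (j + m) x) = w :> seq chi]).
  exact: (measurable_initial_word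
    [set v : (j + m).-tuple chi | drop j v = w :> seq chi]).
apply/seteqP; split=> x /=; rewrite drop_initial_word; first by move=> ->.
exact: val_inj.
Qed.

Lemma measure_shift_cylinder (nu : set (sequence_space chi) -> \bar R) j m
    (w : m.-tuple chi) : stationary nu ->
  nu (iter j (@left_shift chi) @^-1` cylinder w) = nu (cylinder w).
Proof.
move=> st; elim: j => [|j IH]; first by congr nu.
rewrite -IH -[RHS]st; last exact: measurable_shift_cylinder.
by congr nu; apply/seteqP; split=> x; rewrite /= -iterSr.
Qed.

Variables mu nu : probability (sequence_space chi) R.
Hypothesis nu_stationary : stationary nu.

Lemma word_weight_ge0 n (w : n.-tuple chi) : 0 <= word_weight mu nu w.
Proof. by apply: mule_ge0; exact: measure_ge0. Qed.

Definition match_event n m (W : set (m.-tuple chi)) :=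
  [set xy : sequence_space chi * sequence_space chi |
    match_length n m xy.1 xy.2 /\ W (initial_word m xy.1)].

(** Fixing the common word w decouples x from y: the event becomes a countable union of
    rectangles. *)
Lemma match_eventE n m W : @match_event n m W =
  \bigcup_(w in W)
    (cylinder w `*` (iter (n - m) (@left_shift chi) @^-1` cylinder w)).
Proof.
apply/seteqP; split=> -[x y] /=.
  by move=> [h Ww]; exists (initial_word m x).
by move=> [w Ww [/= xw yw]]; rewrite /match_event/match_length/= xw yw.
Qed.

Lemma measurable_match_rectangle n m (w : m.-tuple chi) :
  measurable (cylinder w `*` (iter (n - m) (@left_shift chi) @^-1` cylinder w)
    : set (sequence_space chi * sequence_space chi)).
Proof.
apply: measurableX; last exact: measurable_shift_cylinder.
exact: (@measurable_shift_cylinder 0).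
Qed.

Lemma measurable_match_event n m W : measurable (@match_event n m W).
Proof.
rewrite match_eventE; apply: countable_bigcup_measurable.
  exact: countable_words.
by move=> w _; exact: measurable_match_rectangle.
Qed.

Lemma measure_match_event n m W :
  (mu \x nu) (@match_event n m W) = \esum_(w in W) word_weight mu nu w.
Proof.
rewrite match_eventE measure_countable_bigcup.
- apply: eq_esum => w _; rewrite /word_weight.
  rewrite -(@measure_shift_cylinder nu (n - m) m w)//.
  apply: product_measure1E; last exact: measurable_shift_cylinder.
  exact: (@measurable_shift_cylinder 0).
- exact: countable_words.
- by move=> w _; exact: measurable_match_rectangle.
(* The rectangles are disjoint, as w is the initial word of x. *)
- by move=> v w _ _ [[x y] [[/= <- _] [/= <- _]]].
Qed.

Lemma measure_shortest_path n k : (1 <= k < n)%N ->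
  (mu \x nu) [set xy | k%:R%:E <= n%:R%:E - shortest_path R n xy.1 xy.2]
  = divergence mu nu k + a2_fin mu nu k n.
Proof.
move=> kn; have k0 : (0 < k)%N by case/andP: kn.
pose D m := match_event n (@new_words chi m k).
have -> : [set xy | k%:R%:E <= n%:R%:E - shortest_path R n xy.1 xy.2] =
    \bigcup_(m in [set` index_iota k n]) D m.
  apply/seteqP; split=> -[x y] /=.
    move=> /shortest_path_le -/(_ kn) /match_length_new -/(_ k0) [m km h].
    by exists m => //=; rewrite mem_index_iota.
  move=> [m /=]; rewrite mem_index_iota => km h.
  by apply/shortest_path_le => //; apply/match_length_new => //; exists m.
rewrite measure_fin_bigcup//=; last 2 first.
- move=> m m' /=; rewrite !mem_index_iota => km km'.
  move=> [[x y] [[/= h N] [/= h' N']]].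
  exact: (match_length_new_inj km km' h N h' N').
- by move=> m _; exact: measurable_match_event.
rewrite -fsbig_seq ?iota_uniq// big_ltn; last by case/andP: kn.
congr (_ + _); last by apply: eq_bigr => m _; exact: measure_match_event.
(* For m = k > 0 no j satisfies k <= j <= k - 1, so every word of length k is new. *)
rewrite measure_match_event /divergence; congr esum.
by apply/seteqP; split=> // w _ [j /= kj]; lia.
Qed.

End match_probability.

Theorem theorem5p1 (R : realType) (chi : pointedType)
    (chi_countable : countable [set: chi])
    (mu nu : probability (sequence_space chi) R)
    (mu_stationary : stationary mu) (nu_stationary : stationary nu)
    (nu_complete : complete_grammar nu) :
  (forall n k : nat, (2 <= n)%N -> (1 <= k <= n - 1)%N ->
     (mu \x nu) [set xy | k%:R%:E <= n%:R%:E - shortest_path R n xy.1 xy.2]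
     = divergence mu nu k + a2_fin mu nu k n) /\
  (forall k : nat, (1 <= k)%N ->
     (mu \x nu) [set xy | k%:R%:E <= n%:R%:E - shortest_path R n xy.1 xy.2]
       @[n --> \oo] --> divergence mu nu k + a2_inf mu nu k).
Proof.
split=> [n k n2 kn|k k1]; first by apply: measure_shortest_path => //; lia.
have w0 m (W : set (m.-tuple chi)) : 0 <= \esum_(w in W) word_weight mu nu w.
  by apply: esum_ge0 => w _; exact: word_weight_ge0.
(* The exact formula holds as soon as n > k. *)
apply: (@cvg_trans _ ((divergence mu nu k + a2_fin mu nu k n) @[n --> \oo])).
  apply: near_eq_cvg; exists k.+1 => // n /= kn.
  by rewrite measure_shortest_path//; lia.
(* [a2_fin] is a partial sum of the nonnegative series [a2_inf], so it converges in the extended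
   reals, possibly to +oo; nonnegativity also makes the sum of the limits well defined. *)
apply: cvgeD; [|exact: cvg_cst|apply: is_cvg_nneseries => *; exact: w0].
apply: ge0_adde_def; rewrite inE; first exact: w0.
by apply: nneseries_ge0 => m *; exact: w0.
Qed.
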